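(* Let $U\subset P(m)$ be a shifted order ideal. Then the sequence of non-negative fractions $D(\Delta_0(U)),D(\Delta_1(U)),\ldots,D(\Delta_{d_{\max}(U)}(U))$ is strictly decreasing until it reaches zero; that is, if $0\le t<d_{\max}(U)$, then $$D(\Delta_{t+1}(U))\ \begin{cases}<D(\Delta_t(U)) & \text{if } D(\Delta_t(U))\ne 0,\\ =0 & \text{if } D(\Delta_t(U))=0.\end{cases}$$ Moreover, $D(\Delta_{d_{\max}(U)}(U))=0$.
   Context: Notation. $\mathbb{K}$ is a field, $m\ge 1$, $P(m)=\mathbb{K}[x_1,\ldots,x_m]$; $[n]=\{1,\ldots,n\}$ and $[a,b]=\{c\in\mathbb{N} : a\le c\le b\}$ (empty if $a>b$). Order ideals. A monomial order ideal of $P(m)$ is a finite set $U$ of monomials of $P(m)$ closed under taking divisors; it is always assumed that $1,x_1,\ldots,x_m\in U$. $U$ is shifted if $x_iu\in U$ ($u$ a monomial) and $i<j\le m$ imply $x_ju\in U$. $d_{\max}(U)$ is the maximal degree of a monomial in $U$. Squeezed complexes. Put $d=d_{\max}(U)$ and let $t\ge 0$ be an integer. For $u=x_{i_1}\cdots x_{i_s}\in U$ with $i_1\le\cdots\le i_s$ set $$F_t(u)=\bigcup_{\ell=1}^s\{i_\ell+2(\ell-1),\,i_\ell+2\ell-1\}\cup[m+2s+1,\,m+t+d]\quad\text{if } s\le t,$$ $$F_t(u)=\bigcup_{\ell=1}^t\{i_\ell+2(\ell-1),\,i_\ell+2\ell-1\}\cup\bigcup_{\ell=t+1}^s\{i_\ell+\ell+t-1\}\cup[m+t+s+1,\,m+t+d]\quad\text{if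 } s\ge t.$$ Each $F_t(u)$ is a $(d+t)$-subset of $[m+t+d]$. $\Delta_t(U)$ is the pure $(d+t-1)$-dimensional simplicial complex on vertex set $[m+t+d]$ whose facets are the sets $F_t(u)$, $u\in U$. Singularity index. A ridge of a pure $e$-dimensional simplicial complex $\Delta$ is a face of dimension $e-1$; its degree $\deg(F)$ is the number of facets of $\Delta$ containing it. With $f_{e-1}(\Delta)$ the number of ridges, the singularity index of $\Delta$ is $$D(\Delta)=\frac{\sum_{F\in\Delta,\ \dim F=e-1}\max\{0,\deg(F)-2\}}{f_{e-1}(\Delta)}.$$ *)

(* Defs.v *)
From HB Require Import structures.
From mathcomp Require Import all_boot all_order all_algebra.
From mathcomp Require Import finmap.
From mathcomp Require Import mpoly.

Set Implicit Arguments.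
Unset Strict Implicit.
Unset Printing Implicit Defensive.

Import Order.TTheory GRing.Theory Num.Theory.

Local Open Scope fset_scope.
Local Open Scope nat_scope.

(* A monomial of K[x_1, ..., x_m] is its exponent vector in 'X_{1..m}, which
   does not involve K; the variable x_i is U_(j)%MM for the ordinal j of value
   i - 1.  Divisibility of monomials is the pointwise order (_ <= _)%MM, not
   the degree-lexicographic order (_ <= _)%O. *)

Definition monomial_order_ideal (m : nat) (U : {fset 'X_{1..m}}) : Prop :=
  [/\ forall u v : 'X_{1..m}, u \in U -> (v <= u)%MM -> v \in U,
      0%MM \in U
    & forall i : 'I_m, U_(i)%MM \in U].

Definition shifted (m : nat) (U : {fset 'X_{1..m}}) : Prop :=
  forall (u : 'X_{1..m}) (i j : 'I_m),
    i < j -> (U_(i) + u)%MM \in U -> (U_(j) + u)%MM \in U.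

Definition dmax (m : nat) (U : {fset 'X_{1..m}}) : nat :=
  \max_(u <- U) mdeg u.

(* For u = x_{i_1} ... x_{i_s} with i_1 <= ... <= i_s, this is the sequence
   i_1, ..., i_s of elements of [m] = {1, ..., m}. *)
Definition var_indices (m : nat) (u : 'X_{1..m}) : seq nat :=
  flatten [seq nseq (u i) i.+1 | i <- enum 'I_m].

Definition var_index (m : nat) (u : 'X_{1..m}) (l : nat) : nat :=
  nth 0 (var_indices u) l.-1.

Definition nat_interval (a b : nat) : {fset nat} :=
  [fset c in index_iota a b.+1].

Definition squeezed_facet (m d t : nat) (u : 'X_{1..m}) : {fset nat} :=
  let s := mdeg u in
  let i_ l := var_index u l in
  let pair_ l : {fset nat} := [fset (i_ l + 2 * (l - 1))%N; (i_ l + 2 * l - 1)%N] in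
  if s <= t then
    (\bigcup_(l <- index_iota 1 s.+1) pair_ l)
    `|` nat_interval (m + 2 * s + 1) (m + t + d)
  else
    (\bigcup_(l <- index_iota 1 t.+1) pair_ l)
    `|` (\bigcup_(l <- index_iota t.+1 s.+1) [fset (i_ l + l + t - 1)%N])
    `|` nat_interval (m + t + s + 1) (m + t + d).

(* A simplicial complex is represented by the finite set of its faces, the
   empty face included. *)

Definition squeezed_complex (m t : nat) (U : {fset 'X_{1..m}}) :
    {fset {fset nat}} :=
  \bigcup_(u <- U) fpowerset (squeezed_facet (dmax U) t u).

Section SingularityIndex.
Variables (T : choiceType) (Delta : {fset {fset T}}).

Definition facets : {fset {fset T}} :=
  [fset F in Delta | [forall G : Delta, (F `<=` val G) ==> (val G == F)]].

Definition max_face_card : nat := \max_(F <- Delta) #|` F|.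

(* A face of dimension e - 1 has e vertices, and e + 1 = max_face_card when
   Delta has dimension e. *)
Definition ridges : {fset {fset T}} :=
  [fset F in Delta | #|` F|.+1 == max_face_card].

Definition ridge_degree (F : {fset T}) : nat :=
  #|` [fset G in facets | F `<=` G]|.

(* The truncated subtraction is max (0, deg F - 2). *)
Definition singularity_index : rat :=
  ((\sum_(F <- ridges) (ridge_degree F - 2))%:R / #|` ridges|%:R)%R.

End SingularityIndex.

(* Main.v *)
Require Import Defs.
From mathcomp Require Import all_boot all_order all_algebra.
From mathcomp Require Import finmap.
From mathcomp Require Import mpoly.
From mathcomp Require Import zify.

(** Let d be the largest degree in U.  Multiplying u by a power of a new
    variable x_(m+1) makes it a monomial of degree d, that is, a weakly
    increasing sequence w_0 <= ... <= w_(d-1) in {1, ..., m+1}.  Repeat each of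
    the first t terms of w twice to get a sequence c of length d+t; then the
    facet F_t(u) is the set of the numbers c_p + p.  As U is a shifted order
    ideal, the sequences w that arise form an up-set for the termwise order.

    A ridge contained in a facet F has the form F - {x}.  Among the facets
    containing it, those whose remaining vertex is larger than x are the
    improvements of the flag (F, x).  For a ridge R the flags (F, x) with
    F - {x} = R are linearly ordered by x, so exactly max (0, deg R - k) of them
    have at least k improvements (sum_many_above).  Let M_k(t) be the number of
    flags of the t-th complex with at least k improvements.  Summing over all
    ridges shows that the numerator of the singularity index is M_2(t)
    (sum_ridge_degree), and that the number of ridges is
    M_0(t) - M_1(t) = (d+t) |U| - M_1(t) (card_ridges).

    The improvements are then found explicitly.  Consider a vertex of F_t(u)
    coming from w_l with l >= t, or the lower of the two vertices coming from
    w_l with l < t.  It can be improved exactly when w_l <= m: raise by one the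
    terms of w from position l to the end of the run of terms equal to w_l.  It
    has a second improvement exactly when w_l < m and, in the case l < t, also
    w_l = w_t: otherwise the run ends among the repeated terms, and pairing off
    consecutive vertices forces the new vertex (improvements_end).  The upper
    vertex of a pair has no improvement, again because of the pairing.

    Since w is weakly increasing, w_l = w_(t+1) with l <= t implies w_l = w_t,
    so M_1 and M_2 are nonincreasing in t.  Hence the numerator does not
    increase, whereas the number of ridges strictly increases because
    (d+t) |U| does.  At t = d the term w_d is m+1, which no w_l < m equals, so
    M_2(d) = 0. *)

Set Implicit Arguments.
Unset Strict Implicit.
Unset Printing Implicit Defensive.

Import Order.TTheory GRing.Theory Num.Theory.

Local Open Scope fset_scope.
Local Open Scope nat_scope.

(** * Counting flags of a pure complex *)

Definition extensions (K : {fset {fset nat}}) (R : {fset nat}) : {fset nat} :=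
  [fset v in \bigcup_(F <- K) F | (v \notin R) && (v |` R \in K)].

Definition improvements (K : {fset {fset nat}}) (F : {fset nat}) (x : nat) :
    {fset nat} :=
  [fset v in extensions K (F `\ x) | x < v].

(** The numerator of the singularity index is the case [k = 2], and the number of
    ridges comes from the case [k = 1]. *)
Definition many_improvements (K : {fset {fset nat}}) (k : nat) : nat :=
  \sum_(F <- K) \sum_(x <- F) (k <= #|` improvements K F x|).

Lemma in_extensions K R v :
  (v \in extensions K R) = (v \notin R) && (v |` R \in K).
Proof.
rewrite !inE /=; apply: andb_idl => /andP [_ vR].
by apply/bigfcupP; exists (v |` R); rewrite ?vR ?fset1U1.
Qed.

Lemma in_improvements K F x v :
  (v \in improvements K F x) =
  [&& x < v, v \notin F & v |` (F `\ x) \in K].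
Proof.
rewrite !inE -/(extensions K (F `\ x)) /=.
have := in_extensions K (F `\ x) v; rewrite !inE /= => ->.
case: ltnP => xv; rewrite ?andbF //= andbT.
by have -> : v != x by lia.
Qed.

Lemma card_filter (A : {fset nat}) (P : pred nat) :
  #|` [fset v in A | P v]| = count P A.
Proof.
rewrite -size_filter; apply: perm_size; apply: uniq_perm.
- exact: fset_uniq.
- by rewrite filter_uniq ?fset_uniq.
by move=> v; rewrite mem_filter !inE /= andbC.
Qed.

(** The element of rank i from the top has i elements above it, so all but the
    k largest elements are counted. *)
Lemma sum_many_above (A : {fset nat}) k :
  \sum_(x <- A) (k <= #|` [fset v in A | x < v]|) = #|` A| - k.
Proof.
under eq_bigr => x _ do rewrite card_filter.
set s := sort leq A.
have sA : perm_eq s A by rewrite perm_sort.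
have s_sorted : sorted ltn s.
  by rewrite ltn_sorted_uniq_leq sort_uniq fset_uniq sort_sorted //; exact: leq_total.
rewrite -(perm_big _ sA) /= -(perm_size sA).
under eq_bigr => x _ do rewrite -(permP sA).
elim: s s_sorted {sA} => [|a s IHs] /=; first by rewrite big_nil.
move=> as_path; have /allP a_min := order_path_min ltn_trans as_path.
rewrite big_cons ltnn add0n.
have -> : count [eta leq a.+1] s = size s.
  by apply/eqP; rewrite -all_count; apply/allP => y /a_min.
rewrite (eq_big_seq (fun x => (k <= count (fun v => x < v) s) : nat)); last first.
  by move=> x /a_min /= ax; rewrite ltnNge (ltnW ax).
rewrite IHs ?(path_sorted as_path) //. by case: (leqP k (size s)) => /= ks; lia.
Qed.

Section PureComplex.

Variables (n : nat) (K Delta : {fset {fset nat}}).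
Hypothesis K_card : forall F, F \in K -> #|` F| = n.
Hypothesis K_nonempty : K != fset0.
Hypothesis DeltaP :
  forall G, reflect (exists2 F, F \in K & G `<=` F) (G \in Delta).

Lemma pure_max_face_card : max_face_card Delta = n.
Proof.
apply/eqP; rewrite eqn_leq; apply/andP; split.
  apply/bigmax_leqP_seq => G /DeltaP [F FK GF] _.
  by rewrite -(K_card FK) fsubset_leq_card.
have [F FK] := fset0Pn _ K_nonempty.
by rewrite -(K_card FK); apply: leq_bigmax_seq => //; apply/DeltaP; exists F.
Qed.

Lemma pure_facets : facets Delta = K.
Proof.
apply/fsetP => F; rewrite !inE /=; apply/andP/idP.
  case=> /DeltaP [G GK FG] /forallP F_max.
  have GD : G \in Delta by apply/DeltaP; exists G.
  by have := F_max [` GD]; rewrite /= FG => /eqP <-.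
move=> FK; split; first by apply/DeltaP; exists F.
apply/forallP => -[G /= GD]; apply/implyP => FG.
have /DeltaP [H HK GH] := GD.
rewrite eq_sym eqEfcard FG (K_card FK) -(K_card HK).
exact: fsubset_leq_card.
Qed.

Lemma ridgesP R :
  reflect (exists F x, [/\ F \in K, x \in F & R = F `\ x]) (R \in ridges Delta).
Proof.
rewrite !inE /= pure_max_face_card; apply: (iffP andP); last first.
  case=> F [x [FK xF ->]]; split.
    by apply/DeltaP; exists F => //; apply: fsubsetDl.
  by have := cardfsD1 x F; rewrite xF (K_card FK) => ->.
case=> /DeltaP [F FK RF] /eqP cR.
have : #|` F `\` R| = 1 by rewrite cardfsDS // (K_card FK) -cR subSnn.
move=> /eqP/cardfs1P [x Fx].
have xFR : x \in F `\` R by rewrite Fx fset11.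
move: xFR; rewrite inE => /andP [xR xF].
exists F, x; split => //; rewrite -Fx fsetDDr fsetDv fset0U.
by apply/esym/fsetIidPr.
Qed.

Lemma ridge_degreeE R :
  R \in ridges Delta -> ridge_degree Delta R = #|` extensions K R|.
Proof.
rewrite inE /= pure_max_face_card => /andP [_ /eqP cR].
rewrite /ridge_degree pure_facets.
have -> : [fset G in K | R `<=` G] = [fset v |` R | v in extensions K R].
  apply/fsetP => G; rewrite !inE /=; apply/andP/imfsetP => /=.
    case=> GK RG.
    have : #|` G `\` R| = 1 by rewrite cardfsDS // (K_card GK) -cR subSnn.
    move=> /eqP/cardfs1P [v Gv].
    have vGR : v \in G `\` R by rewrite Gv fset11.
    have GvR : G = v |` R.
      apply/fsetP => y; rewrite -Gv !inE.
      by have [/(fsubsetP RG)->|_] := boolP (y \in R); rewrite ?orbF.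
    exists v => //; rewrite in_extensions -GvR GK andbT.
    by move: vGR; rewrite inE => /andP [].
  case=> v; rewrite in_extensions => /andP [_ vK] ->.
  by split => //; apply: fsubsetUr.
apply: card_in_imfset => /= v v'.
rewrite !in_extensions => /andP [vR _] /andP [v'R _] /fsetP /(_ v).
rewrite fset1U1 !inE (negPf vR) orbF => /esym /eqP; exact.
Qed.

(** Both sides run over the flags: such a flag is given by a facet and one of its
    vertices, or by a ridge and a vertex that completes it. *)
Lemma sum_flags (phi : {fset nat} -> nat -> nat) :
  \sum_(R <- ridges Delta) \sum_(x <- extensions K R) phi R x =
  \sum_(F <- K) \sum_(x <- F) phi (F `\ x) x.
Proof.
pose psi (y : {fset nat} * nat) := phi y.1 y.2.
rewrite -(@big_allpairs_dep _ _ _ _ _ _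
            (fun (R : {fset nat}) (x : nat) => (R, x)) _ (extensions K) psi).
rewrite -(@big_allpairs_dep _ _ _ _ _ _
            (fun (F : {fset nat}) (x : nat) => (F `\ x, x)) _ (fun F => F) psi).
apply/perm_big/uniq_perm.
- apply: allpairs_uniq_dep => [|R _|]; rewrite ?fset_uniq //.
  by move=> [R x] [R' x'] /= _ _ [-> ->].
- apply: allpairs_uniq_dep => [|F _|]; rewrite ?fset_uniq //.
  move=> _ _ /allpairsPdep [F [x [_ xF ->]]] /allpairsPdep [F' [x' [_ x'F' ->]]].
  move=> /= [FF' xx']; move: FF'; rewrite -{}xx' in x'F' * => FF'.
  by congr existT; rewrite -(fsetD1K xF) FF' fsetD1K.
move=> y; apply/allpairsPdep/allpairsPdep => -[].
  move=> R [x [Rridge]]; rewrite in_extensions => /andP [xR xRK] ->.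
  exists (x |` R), x; split => //; first exact: fset1U1.
  by rewrite fsetU1K.
move=> F [x [FK xF ->]]; exists (F `\ x), x; split => //.
  by apply/ridgesP; exists F, x.
by rewrite in_extensions fsetD1K // FK !inE eqxx.
Qed.

Lemma sum_ridge_degree k :
  \sum_(R <- ridges Delta) (ridge_degree Delta R - k) = many_improvements K k.
Proof.
rewrite /many_improvements.
rewrite -(sum_flags (fun R x => k <= #|` [fset v in extensions K R | x < v]|)).
apply: eq_big_seq => R Rridge.
by rewrite sum_many_above ridge_degreeE.
Qed.

Lemma many_improvements0 : many_improvements K 0 = n * #|` K|.
Proof.
rewrite /many_improvements.
under eq_big_seq => F FK do rewrite sum1_size -/(#|` F|) K_card //.
by rewrite big_const_seq count_predT iter_addn_0.
Qed.

(** Every ridge R has positive degree, hence contributes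
    1 + (deg R - 1) = deg R, and the degrees add up to the number of flags. *)
Lemma card_ridges : #|` ridges Delta| + many_improvements K 1 = n * #|` K|.
Proof.
rewrite -many_improvements0 -!sum_ridge_degree -sum1_size -big_split /=.
apply: eq_big_seq => R Rridge; rewrite subn0 subnKC // ridge_degreeE //.
have /ridgesP [F [x [FK xF ->]]] := Rridge.
rewrite cardfs_gt0; apply/fset0Pn; exists x.
by rewrite in_extensions fsetD1K // FK !inE eqxx.
Qed.

Lemma ridges_gt0 : 0 < n -> 0 < #|` ridges Delta|.
Proof.
have [F FK] := fset0Pn _ K_nonempty; rewrite -(K_card FK) !cardfs_gt0.
by case/fset0Pn => x xF; apply/fset0Pn; exists (F `\ x); apply/ridgesP; exists F, x.
Qed.

End PureComplex.

(** * Finite sets as staircases over weakly increasing sequences *)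

Definition weakly_increasing (c : nat -> nat) := {homo c : i j / i <= j}.

(** Adding the position to a weakly increasing sequence is the usual bijection
    between multisets and sets. *)
Definition staircase (n : nat) (c : nat -> nat) : {fset nat} :=
  [fset c p + p | p in iota 0 n].

Lemma staircaseP n c x :
  reflect (exists2 p, p < n & x = c p + p) (x \in staircase n c).
Proof.
apply: (iffP (imfsetP _ _ _ _)) => /= -[p p_n xE]; exists p => //.
  by move: p_n; rewrite mem_iota.
by rewrite mem_iota.
Qed.

Lemma mem_staircase n c p : p < n -> c p + p \in staircase n c.
Proof. by move=> pn; apply/staircaseP; exists p. Qed.

Section Staircase.

Variable c : nat -> nat.
Hypothesis c_incr : weakly_increasing c.

Lemma staircase_ltn p q : (c p + p < c q + q) = (p < q).
Proof.
case: (ltnP p q) => [pq|qp]; first by have := c_incr (ltnW pq); lia.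
by have := c_incr qp; lia.
Qed.

Lemma staircase_inj : injective (fun p => c p + p).
Proof.
by move=> p q /= pq; have := staircase_ltn p q; have := staircase_ltn q p; lia.
Qed.

Lemma card_staircase n : #|` staircase n c| = n.
Proof.
rewrite card_imfset /=; last exact: staircase_inj.
by rewrite undup_id ?iota_uniq ?size_iota.
Qed.

Lemma staircase_rank n p :
  p <= n -> #|` [fset x in staircase n c | x < c p + p]| = p.
Proof.
move=> pn; rewrite -[RHS]card_staircase; congr #|` _|.
apply/fsetP => x; rewrite !inE /=; apply/andP/staircaseP.
  by case=> /staircaseP [q qn ->]; rewrite staircase_ltn => qp; exists q.
case=> q qp ->; rewrite staircase_ltn; split => //.
by apply: mem_staircase; lia.
Qed.

(** On the run from p to k the staircase is an interval; raising the run by one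
    moves the bottom of this interval just above its top. *)
Lemma staircase_bump n (c' : nat -> nat) p k :
  p <= k -> k < n -> c p = c k -> (forall q, c' q = c q + (p <= q <= k)) ->
  staircase n c' = (c k + k).+1 |` (staircase n c `\ (c p + p)).
Proof.
move=> pk kn cpk c'E; apply/fsetP => x; rewrite !inE.
have flat q : p <= q <= k -> c q = c k.
  by move=> /andP [/c_incr cp /c_incr ck]; lia.
apply/staircaseP/orP.
  case=> q qn ->; rewrite c'E.
  case: (boolP (p <= q <= k)) => pqk; last first.
    right; rewrite addn0 mem_staircase // andbT.
    by apply/eqP => /staircase_inj; lia.
  have [->|qk] := eqVneq q k; first by left; apply/eqP; lia.
  right; have -> : c q + true + q = c q.+1 + q.+1.
    by rewrite !flat //; lia.
  rewrite mem_staircase ?andbT; last by lia.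
  by apply/eqP => /staircase_inj; lia.
case=> [/eqP ->|/andP [xp /staircaseP [q qn xE]]].
  by exists k; rewrite // c'E pk leqnn; lia.
case: (boolP (p < q <= k)) => pqk.
  exists q.-1; first by lia.
  by rewrite xE c'E !flat //; lia.
exists q; rewrite // xE c'E.
have qp : (q < p) || (p < q).
  by rewrite -neq_ltn; apply: contra_neq xp => qp; rewrite xE qp.
have -> : (p <= q <= k) = false by lia.
by rewrite addn0.
Qed.

End Staircase.

(** A vertex and its rank in the set determine the value of the sequence. *)
Lemma staircase_eq n c c' :
  weakly_increasing c -> weakly_increasing c' ->
  staircase n c = staircase n c' -> forall p, p < n -> c p = c' p.
Proof.
move=> c_incr c'_incr cc' p pn.
have := mem_staircase c pn; rewrite cc' => /staircaseP [q qn pq].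
have := staircase_rank c_incr (ltnW pn); rewrite cc' pq.
by rewrite (staircase_rank c'_incr (ltnW qn)) => qp; rewrite qp in pq; lia.
Qed.

(** The sequence [w] with each of its first [t] terms repeated twice: [w l]
    occurs at the positions from [l + minn l t] to [l + minn l.+1 t]. *)
Definition stretch (t : nat) (w : nat -> nat) (p : nat) : nat :=
  w (if p < t.*2 then p./2 else p - t).

Lemma stretch_incr t w :
  weakly_increasing w -> weakly_increasing (stretch t w).
Proof. by move=> w_incr p q pq; apply: w_incr; do 2!case: ifP; lia. Qed.

Lemma stretch_first t w l : stretch t w (l + minn l t) = w l.
Proof. by congr w; case: ifP; lia. Qed.

Lemma stretch_last t w l : stretch t w (l + minn l.+1 t) = w l.
Proof. by congr w; case: ifP; lia. Qed.

Lemma staircase_stretch_inj d t w w' :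
  weakly_increasing w -> weakly_increasing w' -> t <= d ->
  staircase (d + t) (stretch t w) = staircase (d + t) (stretch t w') ->
  forall l, l < d -> w l = w' l.
Proof.
move=> w_incr w'_incr td ww' l ld.
have := staircase_eq (stretch_incr t w_incr) (stretch_incr t w'_incr) ww'.
by move=> /(_ (l + minn l t)); rewrite !stretch_first; apply; lia.
Qed.

Lemma stretch_bump d t w w' l k :
  weakly_increasing w -> l <= k < d -> w l = w k ->
  (forall i, w' i = w i + (l <= i <= k)) ->
  staircase (d + t) (stretch t w') =
  (w k + (k + minn k.+1 t)).+1
    |` (staircase (d + t) (stretch t w) `\ (w l + (l + minn l t))).
Proof.
move=> w_incr lkd wlk w'E.
rewrite (@staircase_bump (stretch t w) _ _ _ (l + minn l t) (k + minn k.+1 t)).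
- by rewrite stretch_first stretch_last.
- exact: stretch_incr.
- lia.
- lia.
- by rewrite stretch_first stretch_last.
move=> q; rewrite /stretch w'E; congr (_ + nat_of_bool _).
by case: ltnP; lia.
Qed.

(** In a stretched sequence the terms at positions 2i and 2i+1 are equal when
    i < t, so a vertex of rank 2i is followed by its successor.  This is the only
    obstruction to exchanging a vertex for a larger one. *)
Lemma stretch_pair d t w y i :
  weakly_increasing w -> t <= d -> i < t ->
  y \in staircase (d + t) (stretch t w) ->
  #|` [fset x in staircase (d + t) (stretch t w) | x < y]| = i.*2 ->
  y.+1 \in staircase (d + t) (stretch t w).
Proof.
move=> w_incr td it /staircaseP [p pn ->].
rewrite staircase_rank ?(ltnW pn) //; last exact: stretch_incr.
move=> pE; apply/staircaseP; exists p.+1; first by lia.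
rewrite addnS; congr (_ + _).+1; rewrite /stretch; congr w.
by do 2!case: ifP; lia.
Qed.

(** Once the sequence has reached its largest possible value [m.+1] it stays
    there, so from that point on the staircase has no gap. *)
Lemma stretch_hi d t w m p :
  weakly_increasing w -> (forall i, w i <= m.+1) -> p < d + t ->
  stretch t w p = m.+1 ->
  forall v, stretch t w p + p <= v -> v <= m + (d + t) ->
  v \in staircase (d + t) (stretch t w).
Proof.
move=> w_incr w_le pn wp v; rewrite wp => pv vn.
have pq : p <= v - m.+1 by lia.
apply/staircaseP; exists (v - m.+1); first by lia.
have := stretch_incr t w_incr pq; rewrite wp.
have : stretch t w (v - m.+1) <= m.+1 by exact: w_le.
by lia.
Qed.

(** * Monomials as weakly increasing sequences *)

Section Monomials.

Variable m : nat.
Implicit Types u v : 'X_{1..m}.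

(** The default value is the index of the homogenizing variable x_(m+1): it pads
    the sequence of indices beyond the degree of [u]. *)
Definition indices (u : 'X_{1..m}) (i : nat) : nat := nth m.+1 (var_indices u) i.

(** The degree of [u] in the variables x_1, ..., x_a. *)
Definition low_degree u a := \sum_(j < m | j < a) u j.

Lemma sorted_nth_leq (s : seq nat) (z a i : nat) :
  sorted leq s -> a < z -> (nth z s i <= a) = (i < count (fun x => x <= a) s).
Proof.
move=> s_sorted az; elim: s i s_sorted => [|x s IHs] [|i] /=.
- lia.
- lia.
- move=> xs; case: (leqP x a) => //= ax.
  have /allP x_min := order_path_min leq_trans xs.
  rewrite add0n; apply/esym/negbTE; rewrite -leqNgt leqn0.
  by rewrite -[_ == 0]negbK -lt0n -has_count; apply/hasPn => y /x_min; lia.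
move=> xs; rewrite (IHs _ (path_sorted xs)).
case: (leqP x a) => //= ax.
have /allP x_min := order_path_min leq_trans xs.
have -> : count (fun x => x <= a) s = 0.
  apply/eqP; rewrite -[_ == 0]negbK -lt0n -has_count; apply/hasPn => y /x_min.
  lia.
by [].
Qed.

Lemma var_indices_sorted u : sorted leq (var_indices u).
Proof.
rewrite sorted_pairwise; last exact: leq_trans.
have : pairwise ltn [seq val i | i <- enum 'I_m].
  by rewrite val_enum_ord -sorted_pairwise ?iota_ltn_sorted //; exact: ltn_trans.
rewrite /var_indices; elim: (enum _) => //= j s IHs /andP [/allP j_min s_incr].
rewrite pairwise_cat IHs // andbT; apply/andP; split.
  apply/allrelP => x y; rewrite mem_nseq => /andP [_ /eqP ->].
  case/flattenP => _ /mapP [i i_s ->]; rewrite mem_nseq => /andP [_ /eqP ->].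
  by have := j_min _ (map_f val i_s) => /=; lia.
elim: (u j) => //= r ->; rewrite andbT; apply/allP => x.
by rewrite mem_nseq => /andP [_ /eqP ->].
Qed.

Lemma count_var_indices u a :
  count (fun x => x <= a) (var_indices u) = low_degree u a.
Proof.
rewrite /var_indices count_flatten -map_comp sumnE big_map big_enum /= /low_degree.
rewrite [RHS]big_mkcond; apply: eq_bigr => j _ /=.
by rewrite count_nseq; case: ifP; lia.
Qed.

Lemma size_var_indices u : size (var_indices u) = mdeg u.
Proof.
rewrite /var_indices size_flatten /shape -map_comp sumnE big_map big_enum /=.
by rewrite mdegE; apply: eq_bigr => j _ /=; rewrite size_nseq.
Qed.

(** This Galois connection reduces every statement on index sequences to
    partial degrees, which are additive in the monomial. *)
Lemma indices_leq u i a : a <= m -> (indices u i <= a) = (i < low_degree u a).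
Proof.
by move=> am; rewrite -count_var_indices sorted_nth_leq //; exact: var_indices_sorted.
Qed.

Lemma var_indices_le u x : x \in var_indices u -> x <= m.
Proof.
by case/flattenP => _ /mapP [i _ ->]; rewrite mem_nseq => /andP [_ /eqP ->].
Qed.

Lemma indices_le u i : indices u i <= m.+1.
Proof.
rewrite /indices; have [lt_i|ge_i] := ltnP i (size (var_indices u)).
  exact: leqW (var_indices_le (mem_nth m.+1 lt_i)).
by rewrite nth_default.
Qed.

Lemma indices_default u i : mdeg u <= i -> indices u i = m.+1.
Proof. by move=> ui; rewrite /indices nth_default ?size_var_indices. Qed.

Lemma indices_incr u : weakly_increasing (indices u).
Proof.
move=> i j ij; have [|mj] := leqP (indices u j) m; last first.
  exact: leq_trans (indices_le _ _) mj.
by move=> jm; rewrite indices_leq //; apply: leq_ltn_trans ij _; rewrite -indices_leq.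
Qed.

Lemma eq_indices (x y : nat) :
  x <= m.+1 -> y <= m.+1 -> (forall a, a <= m -> (x <= a) = (y <= a)) -> x = y.
Proof.
move=> xm ym xy; apply/eqP; rewrite eqn_leq; apply/andP; split.
  have [/xy->//|] := leqP y m; lia.
have [/xy<-//|] := leqP x m; lia.
Qed.

Lemma low_degreeD u v a : low_degree (u + v)%MM a = low_degree u a + low_degree v a.
Proof. by rewrite -big_split; apply: eq_bigr => j _; rewrite mnmDE. Qed.

Lemma low_degreeU (j : 'I_m) a : low_degree U_(j)%MM a = (j < a).
Proof.
rewrite /low_degree; under eq_bigr => i _ do rewrite mnm1E.
rewrite big_mkcond (bigD1 j) //= eqxx big1 => [|i /negPf ij]; first by case: ifP.
by rewrite eq_sym ij; case: ifP.
Qed.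

Lemma low_degree_next u (j : 'I_m) : low_degree u j.+1 = low_degree u j + u j.
Proof.
rewrite /low_degree (bigD1 j) //= addnC; congr (_ + _).
by apply: eq_bigl => i; rewrite -val_eqE /=; lia.
Qed.

Lemma low_degree_inj u v :
  (forall a, a <= m -> low_degree u a = low_degree v a) -> u = v.
Proof.
move=> uv; apply/mnmP => j.
have := uv j.+1 (ltn_ord j); rewrite !low_degree_next uv; last exact: ltnW.
by move/addnI.
Qed.

Lemma indices_inj u v d :
  mdeg u <= d -> mdeg v <= d ->
  (forall i, i < d -> indices u i = indices v i) -> u = v.
Proof.
move=> ud vd uv.
have {}uv i : indices u i = indices v i.
  by have [/uv//|di] := ltnP i d; rewrite !indices_default //; lia.
apply: low_degree_inj => a am.
apply/eqP; rewrite eqn_leq [X in X && _]leqNgt [X in _ && X]leqNgt.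
by rewrite -indices_leq // uv indices_leq // ltnn -indices_leq // -uv
  indices_leq // ltnn.
Qed.

End Monomials.

(** * Raising the indices of a monomial in a shifted order ideal *)

Section OrderIdeal.

Variables (m : nat) (U : {fset 'X_{1..m}}).
Hypothesis U_ideal : monomial_order_ideal U.
Hypothesis U_shifted : shifted U.
Implicit Types u v : 'X_{1..m}.

(** Raising the last index equal to j replaces a factor x_j of [u] by x_(j+1),
    or deletes it when j = m; the ideal is closed under both. *)
Lemma bump_one u k :
  u \in U -> indices u k <= m -> indices u k < indices u k.+1 ->
  exists2 u', u' \in U & forall i, indices u' i = indices u i + (i == k).
Proof.
move=> uU; case ukE: (indices u k) => [|j] jm uk1.
  have := indices_leq u k (leq0n m); rewrite ukE leqnn /low_degree.
  by rewrite big_pred0.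
pose J : 'I_m := Ordinal jm.
have lowJ1 : low_degree u j.+1 = k.+1.
  apply/eqP; rewrite eqn_leq -(indices_leq u k jm) ukE leqnn andbT.
  by rewrite leqNgt -(indices_leq u k.+1 jm) -ltnNge.
have lowJ : low_degree u j <= k.
  by rewrite leqNgt -(indices_leq u k (ltnW jm)) ukE ltnn.
have uJ : 0 < u J by have := low_degree_next u J; rewrite /= lowJ1; lia.
pose v := (u - U_(J))%MM.
have uE : u = (U_(J) + v)%MM by rewrite addmC submK // lep1mP -lt0n.
have vU : v \in U.
  by case: U_ideal => dvd _ _; apply: dvd uU _; rewrite /v; exact: lem_subr.
have [u' u'U u'low] : exists2 u', u' \in U &
    forall a, a <= m -> low_degree u a = low_degree u' a + (a == j.+1).
  (* [j] is the 0-based rank of the variable, so [mj1] says that it is x_m. *)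
  have [j1m|mj1] := ltnP j.+1 m.
    exists (U_(Ordinal j1m) + v)%MM.
      by apply: (U_shifted (i := J)); rewrite -?uE //=.
    by move=> a _; rewrite uE !low_degreeD !low_degreeU /=; lia.
  exists v => // a am.
  by rewrite uE low_degreeD low_degreeU /=; lia.
exists u' => // i; apply: (@eq_indices m); first exact: indices_le.
  have [->|ik] := eqVneq i k; first by rewrite ukE; lia.
  by rewrite addn0; exact: indices_le.
move=> a am; rewrite indices_leq //.
have := u'low a am; have [->|ik] := eqVneq i k.
  have := indices_leq u k am; rewrite ukE addn1.
  by case: (ltngtP a j.+1) => [| |->]; rewrite ?lowJ1; lia.
rewrite addn0 indices_leq //.
by case: (ltngtP a j.+1) => [| |->]; rewrite ?lowJ1; lia.
Qed.

(** The terms are raised one at a time from the end of the run, so that the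
    sequence stays weakly increasing. *)
Lemma bump_run u l k :
  u \in U -> l <= k -> indices u l = indices u k -> indices u k <= m ->
  indices u k < indices u k.+1 ->
  exists2 u', u' \in U &
    forall i, indices u' i = indices u i + (l <= i <= k).
Proof.
move=> uU lk; have [r kE] : exists r, k = l + r by exists (k - l); lia.
elim: r k kE {lk} u uU => [|r IHr] k kE u uU ulk ukm uk1.
  have [u' u'U u'E] := bump_one uU ukm uk1.
  by exists u' => // i; rewrite u'E; congr (_ + nat_of_bool _); lia.
have [u1 u1U u1E] := bump_one uU ukm uk1.
have kE' : k = (l + r).+1 by lia.
have ulr : indices u (l + r) = indices u k.
  have := indices_incr u (leq_addr r l).
  by have := indices_incr u (_ : l + r <= k) => /(_ ltac:(lia)); lia.
have eq_l : indices u1 l = indices u l by rewrite u1E; lia.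
have eq_r : indices u1 (l + r) = indices u k by rewrite u1E -ulr; lia.
have [|||u' u'U u'E] := IHr _ erefl u1 u1U.
- by rewrite eq_l eq_r.
- by rewrite eq_r.
- by rewrite eq_r -kE' u1E eqxx addn1.
exists u' => // i; rewrite u'E u1E -addnA; congr (_ + _); lia.
Qed.

Let d := dmax U.

Lemma mdeg_dmax u : u \in U -> mdeg u <= d.
Proof. by move=> uU; exact: leq_bigmax_seq. Qed.

Lemma last_of_run u l :
  u \in U -> indices u l <= m ->
  exists k, [/\ l <= k, k < d, indices u k = indices u l
              & indices u l < indices u k.+1].
Proof.
move=> uU ul; have low i := indices_leq u i ul.
have := low l; rewrite leqnn => /esym l_low.
have kE : low_degree u (indices u l) = (low_degree u (indices u l)).-1.+1 by lia.
set k := (low_degree _ _).-1 in kE; exists k; split.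
- lia.
- rewrite ltnNge; apply/negP => dk.
  have := low k; rewrite kE leqnn indices_default; first by lia.
  exact: leq_trans (mdeg_dmax uU) dk.
- apply/eqP; rewrite eqn_leq low kE leqnn /=.
  by apply: indices_incr; lia.
by rewrite ltnNge low kE ltnn.
Qed.

(** * Improvements in a squeezed complex *)

Section Stage.

Variable t : nat.
Hypothesis td : t <= d.

Definition facet_of u : {fset nat} := staircase (d + t) (stretch t (indices u)).

Definition facet_family : {fset {fset nat}} := [fset facet_of u | u in U].

Lemma facet_of_inj : {in U &, injective facet_of}.
Proof.
move=> u v uU vU /staircase_stretch_inj uv.
apply: (@indices_inj _ _ _ d); rewrite ?mdeg_dmax // => i id.
by apply: uv => //; exact: indices_incr.
Qed.

Lemma card_facet_family : #|` facet_family| = #|` U|.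
Proof. by rewrite card_in_imfset //=; exact: facet_of_inj. Qed.

Lemma card_facet F : F \in facet_family -> #|` F| = d + t.
Proof.
case/imfsetP => u /= _ ->; apply: card_staircase.
exact/stretch_incr/indices_incr.
Qed.

(* The single vertex, or lower vertex of the pair, given by the [l]-th index; and
   the number following the last vertex of the run that ends at index [k]. *)
Let entry u l : nat := indices u l + (l + minn l t).
Let gap u k : nat := (indices u k + (k + minn k.+1 t)).+1.

Lemma gap_notin_facet u k :
  indices u k < indices u k.+1 -> gap u k \notin facet_of u.
Proof.
move=> uk; apply/negP => /staircaseP [p _ pE].
have c_incr := stretch_incr t (indices_incr u).
have := staircase_ltn c_incr (k + minn k.+1 t) p.
rewrite stretch_last -pE ltnSn => /esym kp.
have kp' : k.+1 + minn k.+1 t <= p by lia.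
have := c_incr _ _ kp'; rewrite stretch_first.
by move: pE; rewrite /gap; lia.
Qed.

Lemma bump_facet u l k :
  u \in U -> l <= k < d -> indices u l = indices u k -> indices u k <= m ->
  indices u k < indices u k.+1 ->
  exists u', [/\ u' \in U, indices u' k = (indices u k).+1
               & facet_of u' = gap u k |` (facet_of u `\ entry u l)].
Proof.
move=> uU lkd ulk ukm uk1.
have /andP [lk _] := lkd.
have [u' u'U u'E] := bump_run uU lk ulk ukm uk1.
exists u'; split => //; first by rewrite u'E lk leqnn addn1.
exact: stretch_bump (indices_incr u) lkd ulk u'E.
Qed.

Lemma entry_gap u l k : l <= k -> indices u l = indices u k -> entry u l < gap u k.
Proof. by rewrite /entry /gap => lk ->; lia. Qed.

Lemma improvements_gt0 u l :
  u \in U -> indices u l <= m ->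
  0 < #|` improvements facet_family (facet_of u) (entry u l)|.
Proof.
move=> uU ulm; have [k [lk kd ukl uk1]] := last_of_run uU ulm.
have [||||u' [u'U _ u'E]] := @bump_facet u l k uU; rewrite ?lk ?ukl //.
rewrite cardfs_gt0; apply/fset0Pn; exists (gap u k).
rewrite in_improvements entry_gap // gap_notin_facet ?ukl // -u'E.
exact: in_imfset.
Qed.

(** The hypothesis on [t] says that the run of [l] ends at a position k >= t.
    Raising it puts its last vertex at the first gap; this vertex is not
    repeated, and its value is still at most [m], so it can be raised once more,
    to a larger gap. *)
Lemma improvements_gt1 u l :
  u \in U -> indices u l < m -> (t <= l) || (indices u l == indices u t) ->
  1 < #|` improvements facet_family (facet_of u) (entry u l)|.
Proof.
move=> uU ulm tl; have [k [lk kd ukl uk1]] := last_of_run uU (ltnW ulm).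
have tk : t <= k.
  have [//|kt] := leqP t k.
  have := indices_incr u kt; case/orP: tl => [|/eqP]; lia.
have [||||u1 [u1U u1k u1E]] := @bump_facet u l k uU; rewrite ?lk ?ukl //.
  exact: ltnW.
rewrite ukl in u1k.
have u1km : indices u1 k <= m by rewrite u1k.
have [k' [kk' k'd u1k' u1k1]] := last_of_run u1U u1km.
have [||||u2 [u2U _ u2E]] := @bump_facet u1 k k' u1U; rewrite ?kk' ?u1k' //.
(* As t <= k, the vertex that the first step adds is the one removed by the
   second. *)
have e1 : entry u1 k = gap u k.
  by rewrite /entry /gap u1k ukl; have -> : minn k t = minn k.+1 t by lia.
have g12 : gap u k < gap u1 k' by rewrite -e1 entry_gap.
have v1F : gap u k \notin facet_of u by rewrite gap_notin_facet ?ukl.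
have v2F1 : gap u1 k' \notin facet_of u1 by rewrite gap_notin_facet ?u1k'.
have lt1 : entry u l < gap u k by rewrite entry_gap.
have v2F : gap u1 k' \notin facet_of u.
  apply: contraNN v2F1 => v2F; rewrite u1E !inE v2F andbT.
  by apply/orP; right; lia.
have -> : 2 = #|` [fset gap u k; gap u1 k'] |.
  by rewrite cardfs2; have -> : gap u k != gap u1 k' by lia.
apply: fsubset_leq_card; apply/fsubsetP => v; rewrite in_fset2.
have sub u' : u' \in U -> facet_of u' \in facet_family by move=> ?; apply: in_imfset.
case/orP => /eqP ->; rewrite in_improvements.
  by rewrite lt1 v1F -u1E sub.
rewrite (ltn_trans lt1 g12) v2F /=.
suff -> : gap u1 k' |` (facet_of u `\ entry u l) = facet_of u2 by exact: sub.
by rewrite u2E e1 u1E fsetU1K // !inE negb_and v1F orbT.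
Qed.

(** A smaller new vertex would already lie in the run.  A larger one is excluded
    for one of two reasons: if the run has value [m], all larger numbers are
    vertices already; if the run ends among the repeated terms, its last vertex
    drops to an even rank and has to be followed by its successor. *)
Lemma improvements_end u l k (v : nat) :
  l <= k < d -> indices u k = indices u l -> indices u l < indices u k.+1 ->
  indices u l = m \/ k < t ->
  v \in improvements facet_family (facet_of u) (entry u l) -> v = gap u k.
Proof.
move=> /andP [lk kd] ukl uk1 end_run; rewrite in_improvements.
case/and3P => lt_v vF /imfsetP [/= u' u'U GE].
have c_incr := stretch_incr t (indices_incr u).
have gapE : gap u k = (indices u l + (k + minn k.+1 t)).+1 by rewrite /gap ukl.
apply/eqP; case: ltngtP => // v_gap.
  case/negP: vF; apply/staircaseP.
  exists (v - indices u l); first by rewrite /entry in lt_v; lia.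
  rewrite /entry in lt_v.
  have := c_incr _ _ (_ : l + minn l t <= v - indices u l).
  have := c_incr _ _ (_ : v - indices u l <= k + minn k.+1 t).
  rewrite stretch_first stretch_last ukl => /(_ ltac:(lia)) ? /(_ ltac:(lia)) ?.
  lia.
case: end_run => [ulm|kt].
  have : v \in facet_of u' by rewrite -GE fset1U1.
  case/staircaseP => q qn vE.
  have qm : stretch t (indices u') q <= m.+1 by exact: indices_le.
  case/negP: vF; apply: (@stretch_hi _ _ _ m (k.+1 + minn k.+1 t)).
  - exact: indices_incr.
  - exact: indices_le.
  - lia.
  - rewrite stretch_first; apply/eqP; rewrite eqn_leq indices_le /=; lia.
  - by rewrite stretch_first; have := indices_le u k.+1; lia.
  - lia.
(* [y] is the last vertex of the run: it has rank 2k+1 in the facet and 2k after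
   the exchange. *)
have kE : k + minn k.+1 t = k.*2.+1 by lia.
have yE : indices u l + k.*2.+1 = stretch t (indices u) k.*2.+1 + k.*2.+1.
  by rewrite -kE stretch_last ukl.
rewrite /entry in lt_v; rewrite gapE kE in v_gap.
set y := indices u l + k.*2.+1 in yE v_gap.
have xy : indices u l + (l + minn l t) < y by rewrite /y; lia.
have yF : y \in facet_of u by rewrite yE mem_staircase //; lia.
have := @stretch_pair d t (indices u') y k (indices_incr u') td kt.
rewrite -/(facet_of u') -GE => pair.
have : y.+1 \in facet_of u.
  have : y.+1 \in v |` (facet_of u `\ entry u l).
    apply: pair; first by rewrite !inE yF andbT; apply/orP; right; rewrite /entry; lia.
    have rank : #|` [fset x in facet_of u | x < y]| = k.*2.+1.
      by rewrite yE staircase_rank //; lia.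
    have xF : entry u l \in facet_of u.
      by rewrite /entry -[X in X + _](stretch_first t (indices u) l) mem_staircase //; lia.
    have -> : [fset x in v |` (facet_of u `\ entry u l) | x < y] =
              [fset x in facet_of u | x < y] `\ entry u l.
      have vy : (v < y) = false by lia.
      apply/fsetP => z; rewrite !inE /= andbA.
      by have [->|_] := eqVneq z v; rewrite ?vy ?andbF.
    have := cardfsD1 (entry u l) [fset x in facet_of u | x < y].
    by rewrite rank !inE xF /= xy add1n => -[<-].
  by rewrite !inE => /orP [/eqP|/andP []//]; lia.
have := @gap_notin_facet u k; rewrite ukl gapE kE => /(_ uk1).
by rewrite /y -addnS => /negP.
Qed.


(** The lower vertex of the pair keeps its even rank when the upper one is
    exchanged for a larger vertex, so it would still need the upper one as its
    successor. *)
Lemma improvements_upper u l :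
  l < t ->
  improvements facet_family (facet_of u) (indices u l + l.*2.+1) = fset0.
Proof.
move=> lt; apply/eqP; apply: contraT => /fset0Pn [v].
set x := indices u l + l.*2.+1; rewrite in_improvements.
case/and3P => xv vF /imfsetP [/= u' u'U GE].
pose y := indices u l + l.*2.
have yE : y = stretch t (indices u) l.*2 + l.*2.
  rewrite /y -[X in X + _](stretch_first t (indices u) l).
  by congr (stretch _ _ _ + _); lia.
have yF : y \in facet_of u by rewrite yE mem_staircase //; lia.
have yx : y.+1 = x by rewrite /x addnS.
have := @stretch_pair d t (indices u') y l (indices_incr u') td lt.
rewrite -/(facet_of u') -GE yx !inE eqxx /= => pair.
have /orP [/eqP xv'|//] : (x == v) || false; last by rewrite xv' ltnn in xv.
apply: pair; first by rewrite yF andbT; apply/orP; right; lia.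
rewrite -[RHS](@staircase_rank _ (stretch_incr t (indices_incr u)) (d + t)); last by lia.
rewrite -yE; congr #|` _|; apply/fsetP => z; rewrite !inE /=.
have [->|_] := eqVneq z v.
  by rewrite (negPf vF) /=; lia.
by have [->|_] //= := eqVneq z x; rewrite -yx ltnNge leqnSn andbF.
Qed.

(** An index equal to [m.+1] belongs to the part of the facet above which there
    is no gap. *)
Lemma improvements_gt0E u l :
  u \in U -> l < d ->
  (0 < #|` improvements facet_family (facet_of u) (entry u l)|) =
  (indices u l <= m).
Proof.
move=> uU ld; apply/idP/idP; last exact: improvements_gt0.
rewrite cardfs_gt0 => /fset0Pn [v]; rewrite in_improvements.
case/and3P => xv vF /imfsetP [/= u' u'U GE]; rewrite leqNgt; apply: contra vF => mul.
have ul : indices u l = m.+1 by apply/eqP; rewrite eqn_leq mul indices_le.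
have : v \in facet_of u' by rewrite -GE fset1U1.
case/staircaseP => q qn vE.
have qm : stretch t (indices u') q <= m.+1 by exact: indices_le.
apply: (@stretch_hi _ _ _ m (l + minn l t)).
- exact: indices_incr.
- exact: indices_le.
- lia.
- by rewrite stretch_first.
- by rewrite stretch_first ltnW.
lia.
Qed.

Lemma improvements_gt1E u l :
  u \in U -> l < d ->
  (1 < #|` improvements facet_family (facet_of u) (entry u l)|) =
  (indices u l < m) && ((t <= l) || (indices u l == indices u t)).
Proof.
move=> uU ld; apply/idP/idP; last by case/andP; exact: improvements_gt1.
apply: contraLR => end_run; rewrite -leqNgt.
have [ulm|mul] := leqP (indices u l) m; last first.
  by rewrite leqNgt; apply/negP => /ltnW; rewrite improvements_gt0E // leqNgt mul.
have [k [lk kd ukl uk1]] := last_of_run uU ulm.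
rewrite -(cardfs1 (gap u k)); apply: fsubset_leq_card; apply/fsubsetP => v.
move=> /(@improvements_end _ _ k) -> //; rewrite ?fset11 ?lk //.
move: ulm; rewrite leq_eqVlt => /orP [/eqP ->|ulm]; [by left | right].
move: end_run; rewrite ulm /= negb_or -ltnNge => /andP [lt /negP ult].
rewrite ltnNge; apply/negP => tk; apply: ult; rewrite eqn_leq.
by rewrite (indices_incr u (ltnW lt)) /= -ukl; exact: indices_incr.
Qed.

Lemma sum_facet u (g : nat -> nat) :
  \sum_(x <- facet_of u) g x =
  \sum_(0 <= l < d) g (entry u l) + \sum_(0 <= l < t) g (indices u l + l.*2.+1).
Proof.
pose h p := g (stretch t (indices u) p + p).
have -> : \sum_(x <- facet_of u) g x = \sum_(0 <= p < d + t) h p.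
  rewrite big_imfset /=; last first.
    by move=> p q _ _; exact: staircase_inj (stretch_incr t (indices_incr u)) _ _.
  by rewrite undup_id ?iota_uniq // /index_iota subn0.
have pairs r : \sum_(0 <= p < r.*2) h p =
    \sum_(0 <= l < r) h l.*2 + \sum_(0 <= l < r) h l.*2.+1.
  elim: r => [|r IHr]; first by rewrite !big_geq.
  by rewrite doubleS !big_nat_recr //= IHr; lia.
rewrite (@big_cat_nat _ _ _ t.*2) //=; last by lia.
rewrite [X in _ = X + _](@big_cat_nat _ _ _ t) //= pairs addnAC.
congr (_ + _ + _).
- apply: eq_big_nat => l /andP [_ lt]; rewrite /h /entry; congr g.
  have -> : l.*2 = l + minn l t by lia.
  by rewrite stretch_first.
- rewrite -addnn big_addn; have -> : d + t - t = d by lia.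
  apply: eq_big_nat => l /andP [tl _]; rewrite /h /entry; congr g.
  have -> : l + t = l + minn l t by lia.
  by rewrite stretch_first.
apply: eq_big_nat => l /andP [_ lt]; rewrite /h; congr g.
have -> : l.*2.+1 = l + minn l.+1 t by lia.
by rewrite stretch_last.
Qed.

Lemma many_improvements_facet k :
  0 < k ->
  many_improvements facet_family k =
  \sum_(u <- U) \sum_(0 <= l < d)
    (k <= #|` improvements facet_family (facet_of u) (entry u l)|).
Proof.
move=> k0; rewrite /many_improvements big_imfset /=; last exact: facet_of_inj.
apply: eq_big_seq => u uU; rewrite sum_facet [X in _ + X]big1_seq ?addn0 //.
move=> l /andP [_]; rewrite mem_index_iota => lt.
by rewrite improvements_upper // cardfs0 leqNgt k0.
Qed.

Lemma facet_ofP u x :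
  reflect ((exists2 i, i < d & x = entry u i) \/
           (exists2 i, i < t & x = indices u i + i.*2.+1))
          (x \in facet_of u).
Proof.
apply: (iffP (staircaseP _ _ _)) => [[p pn ->]|[[i id ->]|[i it ->]]].
- have [pt|tp] := ltnP p t.*2; last first.
    left; exists (p - t); first by lia.
    rewrite /entry; have pE : p = p - t + minn (p - t) t by lia.
    by rewrite {1 2}pE stretch_first; lia.
  have [podd|peven] := boolP (odd p).
    right; exists p./2; first by lia.
    have pE : p = p./2 + minn p./2.+1 t by lia.
    by rewrite {1 2}pE stretch_last; lia.
  left; exists p./2; first by lia.
  rewrite /entry; have pE : p = p./2 + minn p./2 t by lia.
  by rewrite {1 2}pE stretch_first; lia.
- by exists (i + minn i t); [lia | rewrite stretch_first].
exists (i + minn i.+1 t); first by lia.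
by rewrite stretch_last; lia.
Qed.

Lemma var_indexE u l : 0 < l -> l <= mdeg u -> var_index u l = indices u l.-1.
Proof.
by move=> l0 lu; apply: set_nth_default; rewrite size_var_indices; lia.
Qed.

Lemma mem_nat_interval a b x : (x \in nat_interval a b) = (a <= x <= b).
Proof. by rewrite !inE /= mem_index_iota ltnS. Qed.

(** Padding the index sequence with [m.+1] makes the final interval in the
    definition of a facet part of the staircase, so that the two cases of that
    definition agree. *)
Lemma squeezed_facetE u : mdeg u <= d -> squeezed_facet d t u = facet_of u.
Proof.
move=> ud; set s := mdeg u in ud.
pose pairs r := \bigcup_(l <- index_iota 1 r.+1)
  [fset (var_index u l + 2 * (l - 1))%N; (var_index u l + 2 * l - 1)%N].
have pairsP r x : r <= s ->
    reflect (exists2 i, i < r & x = indices u i + i.*2 \/ x = indices u i + i.*2.+1)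
            (x \in pairs r).
  move=> rs; apply: (iffP (bigfcupP _ _ _ _)) => [[l]|[i ir xE]].
    rewrite mem_index_iota in_fset2 andbT => /andP [l0 lr].
    rewrite var_indexE //; last by lia.
    by move=> xE; exists l.-1; [lia | case/orP: xE => /eqP ->; [left | right]; lia].
  exists i.+1; first by rewrite mem_index_iota andbT; lia.
  rewrite in_fset2 var_indexE //=; last by lia.
  by apply/orP; case: xE => ->; [left | right]; apply/eqP; lia.
have default i : s <= i -> indices u i = m.+1 by exact: indices_default.
apply/fsetP => x; apply/idP/facet_ofP; rewrite /squeezed_facet -/s; case: leqP => st.
- rewrite in_fsetU -/(pairs s) mem_nat_interval.
  case/orP => [/pairsP -/(_ (leqnn s)) [i is_ [->|->]]|x_hi].
  + by left; exists i; rewrite /entry; lia.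
  + by right; exists i; lia.
  have [xt|tx] := leqP (m + t.*2).+1 x.
    by left; exists (x - m.+1 - t); rewrite /entry ?default; lia.
  have [xo|xe] := boolP (odd (x - m.+1)).
    by right; exists (x - m.+1)./2; rewrite ?default; lia.
  by left; exists (x - m.+1)./2; rewrite /entry ?default; lia.
- rewrite !in_fsetU -/(pairs t) mem_nat_interval -orbA.
  case/or3P => [/pairsP -/(_ (ltnW st)) [i it [->|->]]|/bigfcupP [l]|x_hi].
  + by left; exists i; rewrite /entry; lia.
  + by right; exists i; lia.
  + rewrite mem_index_iota andbT in_fset1 => ls; rewrite var_indexE; [|lia|lia].
    by move/eqP => ->; left; exists l.-1; rewrite /entry; lia.
  by left; exists (x - m.+1 - t); rewrite /entry ?default; lia.
- rewrite in_fsetU -/(pairs s) mem_nat_interval => xF.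
  apply/orP; case: xF => -[i ilt ->].
    have [is_|si] := ltnP i s; last by right; rewrite /entry default; lia.
    by left; apply/pairsP => //; exists i => //; left; rewrite /entry; lia.
  have [is_|si] := ltnP i s; last by right; rewrite default; lia.
  by left; apply/pairsP => //; exists i => //; right.
rewrite !in_fsetU -/(pairs t) mem_nat_interval -orbA => xF.
apply/or3P; case: xF => -[i ilt ->]; last first.
  by apply: Or31; apply/pairsP; [lia | exists i => //; right].
have [it|ti] := ltnP i t.
  by apply: Or31; apply/pairsP; [lia | exists i => //; left; rewrite /entry; lia].
have [is_|si] := ltnP i s; last by apply: Or33; rewrite /entry default; lia.
apply: Or32; apply/bigfcupP; exists i.+1; first by rewrite mem_index_iota; lia.
by rewrite in_fset1 var_indexE // /entry /=; apply/eqP; lia.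
Qed.

Lemma squeezed_complexP G :
  reflect (exists2 F, F \in facet_family & G `<=` F) (G \in squeezed_complex t U).
Proof.
apply: (iffP (bigfcupP _ _ _ _)) => [[u]|[_ /imfsetP [u /= uU ->] GF]].
  rewrite andbT fpowersetE => uU; rewrite squeezed_facetE ?mdeg_dmax // => GF.
  by exists (facet_of u) => //; exact: in_imfset.
by exists u; rewrite ?uU // fpowersetE squeezed_facetE ?mdeg_dmax.
Qed.

Lemma facet_family_nonempty : facet_family != fset0.
Proof.
apply/fset0Pn; exists (facet_of 0%MM); apply: in_imfset => /=.
by case: U_ideal.
Qed.

Lemma squeezed_numerator :
  \sum_(R <- ridges (squeezed_complex t U))
     (ridge_degree (squeezed_complex t U) R - 2) =
  many_improvements facet_family 2.
Proof.
exact: sum_ridge_degree card_facet facet_family_nonempty squeezed_complexP _.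
Qed.

Lemma card_squeezed_ridges :
  #|` ridges (squeezed_complex t U)| + many_improvements facet_family 1 =
  (d + t) * #|` U|.
Proof.
rewrite -card_facet_family.
exact: card_ridges card_facet facet_family_nonempty squeezed_complexP.
Qed.

Lemma squeezed_ridges_gt0 : 0 < d -> 0 < #|` ridges (squeezed_complex t U)|.
Proof.
move=> d0; apply: (ridges_gt0 card_facet facet_family_nonempty squeezed_complexP).
by rewrite addn_gt0 d0.
Qed.

End Stage.

(** * Comparing consecutive stages *)

Lemma many_improvements_anti t k :
  t < d -> k \in [:: 1; 2] ->
  many_improvements (facet_family t.+1) k <= many_improvements (facet_family t) k.
Proof.
move=> td k12; have k0 : 0 < k by case: k k12.
rewrite !many_improvements_facet //; last exact: ltnW.
rewrite big_seq [X in _ <= X]big_seq; apply: leq_sum => u uU.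
rewrite !big_mkord; apply: leq_sum => l _.
move: k12; rewrite !inE => /orP [] /eqP ->.
  by rewrite !improvements_gt0E // ltnW.
rewrite !improvements_gt1E //; last exact: ltnW.
case: (_ < m) => //=; case: orP => // run.
suff -> : (t <= l) || (indices u l == indices u t) by [].
have [//|lt] := leqP t l; case: run => [|/eqP ult]; first lia.
have := indices_incr u (ltnW lt); have := indices_incr u (leqnSn t).
by rewrite -ult => ? ?; rewrite /= eqn_leq; lia.
Qed.

Lemma card_squeezed_ridges_mono t :
  t < d ->
  #|` ridges (squeezed_complex t U)| < #|` ridges (squeezed_complex t.+1 U)|.
Proof.
move=> td; have := card_squeezed_ridges td.
have := card_squeezed_ridges (ltnW td).
have := many_improvements_anti td (mem_head 1 [:: 2]).
have : 0 < #|` U|.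
  by rewrite cardfs_gt0; apply/fset0Pn; exists 0%MM; case: U_ideal.
by rewrite addnS mulSn; lia.
Qed.

Lemma many_improvements_last : many_improvements (facet_family d) 2 = 0.
Proof.
rewrite many_improvements_facet // big1_seq // => u /andP [_ uU].
rewrite big1_seq // => l /andP [_]; rewrite mem_index_iota /= => ld.
rewrite improvements_gt1E // [d <= l]leqNgt ld /= (@indices_default _ u d) ?mdeg_dmax //.
by apply/eqP; rewrite eqb0 negb_and -leqNgt; case: eqP => [->|]; rewrite ?leqnSn ?orbT.
Qed.

End OrderIdeal.

Theorem theorem5p12 (m : nat) (U : {fset 'X_{1..m}}) :
  (1 <= m)%N ->
  monomial_order_ideal U ->
  shifted U ->
  let D (t : nat) : rat := singularity_index (squeezed_complex t U) in
  (forall t : nat, (t < dmax U)%N ->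
     (D t <> 0%R -> (D t.+1 < D t)%R) /\ (D t = 0%R -> D t.+1 = 0%R))
  /\ D (dmax U) = 0%R.
Proof.
move=> _ U_ideal U_shifted /=; rewrite /singularity_index; split=> [t td|]; last first.
  by rewrite squeezed_numerator // many_improvements_last // mul0r.
rewrite !squeezed_numerator //; last exact: ltnW.
have := many_improvements_anti U_ideal U_shifted td (mem_last 1 [:: 2]).
have := card_squeezed_ridges_mono U_ideal U_shifted td.
have := squeezed_ridges_gt0 U_ideal (ltnW td) (leq_ltn_trans (leq0n t) td).
set f := #|` ridges (squeezed_complex t U)|.
set f' := #|` ridges (squeezed_complex t.+1 U)|.
set N := many_improvements (facet_family U t) 2.
set N' := many_improvements (facet_family U t.+1) 2.
move=> f0 ff' N'N; have f'0 := ltn_trans f0 ff'.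
have nz_f : (f%:R != 0 :> rat)%R by rewrite pnatr_eq0 -lt0n.
split=> [D_neq0|/eqP]; last first.
  rewrite mulf_eq0 invr_eq0 (negPf nz_f) orbF pnatr_eq0 => /eqP N0.
  by move: N'N; rewrite N0 leqn0 => /eqP ->; rewrite mul0r.
have N_gt0 : 0 < N by rewrite lt0n; apply/eqP => N0; apply: D_neq0; rewrite N0 mul0r.
rewrite ltr_pdivrMr ?ltr0n // mulrAC ltr_pdivlMr ?ltr0n // -!natrM ltr_nat.
apply: leq_ltn_trans (leq_mul N'N (leqnn f)) _.
by rewrite ltn_pmul2l.
Qed.
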